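(* If a multiparty session $\mathcal{M}$ is well typed, i.e. $\vdash\mathcal{M}:\mathsf{G}$ for some well-formed global type $\mathsf{G}$, then $\mathcal{M}$ is lock-free.
   Context: Processes are possibly infinite regular trees (finitely many distinct subtrees) generated coinductively by $P ::= \mathbf{0}\mid \mathsf{p}?\Lambda\mid \mathsf{p}!\Lambda$ with $\Lambda=\{\ell_1.P_1,\dots,\ell_n.P_n\}$ ($n\ge1$, distinct messages); $\mathsf{p}?\Lambda$ is input from $\mathsf{p}$, $\mathsf{p}!\Lambda$ output to $\mathsf{p}$. $\mathrm{lab}(\Lambda)$ is its set of messages; $\ell.P\oplus\Lambda$ is $\{\ell.P\}\cup\Lambda$ with $\ell\notin\mathrm{lab}(\Lambda)$, $\Lambda_1\oplus\Lambda_2$ a union with disjoint label sets. $\mathrm{pt}(P)$ is the set of participants in $P$. A multiparty session is $\prod_{i\in I}\mathsf{p}_i[P_i]$ with distinct $\mathsf{p}_i\notin\mathrm{pt}(P_i)$. $\equiv$ makes $\mid$ commutative, associative with neutral $\mathsf{p}[\mathbf{0}]$ (any fresh $\mathsf{p}$). Reduction is the closure under $\equiv$ of: if $\mathrm{lab}(\Lambda)\subseteq\mathrm{lab}(\Lambda')$ then $\mathsf{p}[\mathsf{q}!(\ell.P\oplus\Lambda)]\mid\mathsf{q}[\mathsf{p}?(\ell.Q\oplus\Lambda')]\mid\mathcal{M}\xrightarrow{\mathsf{p}\ell\mathsf{q}}\mathsf{p}[P]\mid\mathsf{q}[Q]\mid\mathcal{M}$; $\to^*$ is the reflexive transitive closure.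 $\mathcal{M}$ is lock-free if (a) $\mathcal{M}\to^*\mathcal{M}'$ implies $\mathcal{M}'\equiv\mathsf{p}[\mathbf{0}]$ or $\mathcal{M}'\to\mathcal{M}''$ for some $\mathcal{M}''$; and (b) $\mathcal{M}\to^*\mathsf{p}[P]\mid\mathcal{M}'$ with $P\neq\mathbf{0}$ implies $\mathsf{p}[P]\mid\mathcal{M}'\to^*\mathcal{M}''\xrightarrow{\lambda}$ for some $\mathcal{M}''$ and label $\lambda=\mathsf{r}\ell\mathsf{s}$ in which $\mathsf{p}\in\{\mathsf{r},\mathsf{s}\}$. Global types: regular trees generated coinductively by $\mathsf{G}::=\mathtt{end}\mid\mathsf{p}\to\mathsf{q}:\{\ell_i.\mathsf{G}_i\}_{i\le n}$ (distinct messages); $\mathrm{pt}(\mathsf{G})$ its participants. Projection (partial, coinductive): $\mathsf{G}\!\upharpoonright\!\mathsf{p}=\mathbf{0}$ if $\mathsf{p}\notin\mathrm{pt}(\mathsf{G})$; $(\mathsf{p}\to\mathsf{q}:\{\ell_i.\mathsf{G}_i\})\!\upharpoonright\!\mathsf{p}=\mathsf{q}!\{\ell_i.(\mathsf{G}_i\!\upharpoonright\!\mathsf{p})\}$; $(\mathsf{q}\to\mathsf{p}:\{\ell_i.\mathsf{G}_i\})\!\upharpoonright\!\mathsf{p}=\mathsf{q}?\{\ell_i.(\mathsf{G}_i\!\upharpoonright\!\mathsf{p})\}$; for $\mathsf{p}\notin\{\mathsf{q},\mathsf{r}\}$, $(\mathsf{q}\to\mathsf{r}:\{\ell_i.\mathsf{G}_i\}_{i\le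 n})\!\upharpoonright\!\mathsf{p}$ is $\mathsf{G}_1\!\upharpoonright\!\mathsf{p}$ if all $\mathsf{G}_i\!\upharpoonright\!\mathsf{p}$ coincide, is $\mathsf{s}?(\Lambda_1\oplus\cdots\oplus\Lambda_n)$ if $\mathsf{G}_i\!\upharpoonright\!\mathsf{p}=\mathsf{s}?\Lambda_i$ for all $i$ with pairwise disjoint label sets, undefined otherwise. For a path $\pi$ of $\mathsf{G}$ from the root, $d(\pi,\mathsf{p})$ is the number of communications before the first one involving $\mathsf{p}$ (the length of $\pi$, possibly $\infty$, if none); the weight of $\mathsf{p}$ in $\mathsf{G}$ is $\sup_\pi d(\pi,\mathsf{p})$ if $\mathsf{p}\in\mathrm{pt}(\mathsf{G})$, else $0$. $\mathsf{G}$ is well formed if each $\mathsf{p}\in\mathrm{pt}(\mathsf{G})$ has finite weight and defined projection. Structural preorder $\leqslant$: largest relation with $P\leqslant Q$ implying $P=Q=\mathbf{0}$, or $P=\mathsf{p}?(\{\ell_i.P_i\}_{i\le n}\oplus\Lambda)$, $Q=\mathsf{p}?\{\ell_i.Q_i\}_{i\le n}$, $P_i\leqslant Q_i$, or $P=\mathsf{p}!\{\ell_i.P_i\}_{i\le n}$, $Q=\mathsf{p}!\{\ell_i.Q_i\}_{i\le n}$, $P_i\leqslant Q_i$. Typing: $\vdash\prod_{i\in I}\mathsf{p}_i[P_i]:\mathsf{G}$ iff $P_i\leqslant\mathsf{G}\!\upharpoonright\!\mathsf{p}_i$ for all $i$ and $\mathrm{pt}(\mathsf{G})\subseteq\{\mathsf{p}_i\}_{i\in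 I}$. *)

(* Defs.v *)
(* Processes and global types are coinductive trees.  Leibniz equality on a
   coinductive type is finer than equality of trees, so equality of trees is
   rendered by the bisimilarities [proc_eq] and [gtype_eq]. *)
From Stdlib Require Import Arith List Permutation Relations.
Import ListNotations.

Set Implicit Arguments.

Definition participant := nat.
Definition message := nat.

(* A set {l_1.T_1, ..., l_n.T_n} with distinct messages l_i is a partial map
   from messages to continuations; that it is finite with n >= 1 is required
   separately, by [proper]. *)
Definition branches (T : Type) := message -> option T.

Definition lab {T} (L : branches T) (l : message) : Prop := L l <> None.

Definition proper {T} (L : branches T) : Prop :=
  (exists l, lab L l) /\ (exists s : list message, forall l, lab L l -> In l s).

(* l.T (+) L; to be used with ~ lab L l *)
Definition badd {T} (l : message) (t : T) (L : branches T) : branches T :=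
  fun m => if Nat.eqb m l then Some t else L m.

(* L = (+)_{i in I} Ls i, a union with pairwise disjoint label sets *)
Definition is_oplus {T} (I : message -> Prop) (Ls : message -> branches T)
    (L : branches T) : Prop :=
  (forall i j l, I i -> I j -> lab (Ls i) l -> lab (Ls j) l -> i = j) /\
  (forall l t, L l = Some t <-> exists i, I i /\ Ls i l = Some t).

(** * Processes *)

CoInductive proc : Type :=
| PEnd : proc
| PIn : participant -> branches proc -> proc
| POut : participant -> branches proc -> proc.

CoInductive proc_eq : proc -> proc -> Prop :=
| proc_eq_end : proc_eq PEnd PEnd
| proc_eq_in p L L' :
    (forall l, lab L l <-> lab L' l) ->
    (forall l P P', L l = Some P -> L' l = Some P' -> proc_eq P P') ->
    proc_eq (PIn p L) (PIn p L')
| proc_eq_out p L L' :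
    (forall l, lab L l <-> lab L' l) ->
    (forall l P P', L l = Some P -> L' l = Some P' -> proc_eq P P') ->
    proc_eq (POut p L) (POut p L').

(* [proc_sub P Q]: Q is a subtree of P *)
Inductive proc_sub : proc -> proc -> Prop :=
| proc_sub_refl P : proc_sub P P
| proc_sub_in p L l P Q : L l = Some P -> proc_sub P Q -> proc_sub (PIn p L) Q
| proc_sub_out p L l P Q : L l = Some P -> proc_sub P Q -> proc_sub (POut p L) Q.

Definition is_process (P : proc) : Prop :=
  (forall p L, proc_sub P (PIn p L) \/ proc_sub P (POut p L) -> proper L) /\
  (exists s : list proc,
     forall Q, proc_sub P Q -> exists Q', In Q' s /\ proc_eq Q Q').

(* p \in pt(P) *)
Inductive proc_pt (p : participant) : proc -> Prop :=
| proc_pt_in L : proc_pt p (PIn p L)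
| proc_pt_out L : proc_pt p (POut p L)
| proc_pt_in_next q L l P : L l = Some P -> proc_pt p P -> proc_pt p (PIn q L)
| proc_pt_out_next q L l P : L l = Some P -> proc_pt p P -> proc_pt p (POut q L).

(** * Multiparty sessions *)

(* The product of the p_i[P_i] is the list of the pairs (p_i, P_i). *)
Definition session := list (participant * proc).

Definition participants (M : session) : list participant := map fst M.

Definition is_session (M : session) : Prop :=
  NoDup (participants M) /\
  (forall p P, In (p, P) M -> is_process P /\ ~ proc_pt p P).

(* Associativity is built into lists; [scong_proc] identifies processes that
   are equal as trees. *)
Inductive scong : session -> session -> Prop :=
| scong_perm M M' : Permutation M M' -> scong M M'
| scong_neutral p M : ~ In p (participants M) -> scong ((p, PEnd) :: M) M
| scong_proc p P P' M : proc_eq P P' -> scong ((p, P) :: M) ((p, P') :: M)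
| scong_sym M M' : scong M M' -> scong M' M
| scong_trans M M' M'' : scong M M' -> scong M' M'' -> scong M M''.

(* The label p l q is the triple (p, l, q). *)
Definition comm := (participant * message * participant)%type.

Definition involved (p : participant) (c : comm) : Prop :=
  let '(r, _, s) := c in p = r \/ p = s.

Inductive red : session -> comm -> session -> Prop :=
| red_comm p q l P Q L L' M :
    ~ lab L l -> ~ lab L' l ->
    (forall m, lab L m -> lab L' m) ->
    red ((p, POut q (badd l P L)) :: (q, PIn p (badd l Q L')) :: M)
        (p, l, q)
        ((p, P) :: (q, Q) :: M)
| red_scong M1 M1' c M2 M2' :
    scong M1 M1' -> red M1' c M2' -> scong M2' M2 -> red M1 c M2.

(* ->*, on sessions up to structural congruence *)
Definition reds : session -> session -> Prop :=
  clos_refl_trans session (fun M M' => scong M M' \/ exists c, red M c M').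

Definition lock_free (M : session) : Prop :=
  (forall M', reds M M' ->
     (exists p, scong M' [(p, PEnd)]) \/ (exists c M'', red M' c M'')) /\
  (forall p P M', reds M ((p, P) :: M') -> P <> PEnd ->
     exists M'' c M''',
       reds ((p, P) :: M') M'' /\ red M'' c M''' /\ involved p c).

(** * Global types *)

(* [GComm p q L] is p -> q : L *)
CoInductive gtype : Type :=
| GEnd : gtype
| GComm : participant -> participant -> branches gtype -> gtype.

CoInductive gtype_eq : gtype -> gtype -> Prop :=
| gtype_eq_end : gtype_eq GEnd GEnd
| gtype_eq_comm p q L L' :
    (forall l, lab L l <-> lab L' l) ->
    (forall l G G', L l = Some G -> L' l = Some G' -> gtype_eq G G') ->
    gtype_eq (GComm p q L) (GComm p q L').

(* [gtype_sub G H]: H is a subtree of G *)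
Inductive gtype_sub : gtype -> gtype -> Prop :=
| gtype_sub_refl G : gtype_sub G G
| gtype_sub_comm p q L l G H :
    L l = Some G -> gtype_sub G H -> gtype_sub (GComm p q L) H.

Definition is_gtype (G : gtype) : Prop :=
  (forall p q L, gtype_sub G (GComm p q L) -> proper L) /\
  (exists s : list gtype,
     forall H, gtype_sub G H -> exists H', In H' s /\ gtype_eq H H').

(* p \in pt(G) *)
Inductive gtype_pt (p : participant) : gtype -> Prop :=
| gtype_pt_sender q L : gtype_pt p (GComm p q L)
| gtype_pt_receiver q L : gtype_pt p (GComm q p L)
| gtype_pt_next q r L l G :
    L l = Some G -> gtype_pt p G -> gtype_pt p (GComm q r L).

(* [projects G p P]: the projection of G on p is P.  The hypotheses
   [gtype_pt p _] give precedence to the clause for p \notin pt(G); without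
   them the coinductive reading of [projects_same] would let any P be a
   projection of the type that solves G = q -> r : {l.G}. *)
CoInductive projects : gtype -> participant -> proc -> Prop :=
| projects_notin G p : ~ gtype_pt p G -> projects G p PEnd
| projects_sender p q L Lp :
    (forall l, lab L l <-> lab Lp l) ->
    (forall l G P, L l = Some G -> Lp l = Some P -> projects G p P) ->
    projects (GComm p q L) p (POut q Lp)
| projects_receiver p q L Lp :
    q <> p ->
    (forall l, lab L l <-> lab Lp l) ->
    (forall l G P, L l = Some G -> Lp l = Some P -> projects G p P) ->
    projects (GComm q p L) p (PIn q Lp)
| projects_same p q r L P :
    p <> q -> p <> r -> gtype_pt p (GComm q r L) ->
    (forall l G, L l = Some G -> projects G p P) ->
    projects (GComm q r L) p P
| projects_disjoint p q r s L Ls Lp :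
    p <> q -> p <> r -> gtype_pt p (GComm q r L) ->
    (forall l G, L l = Some G -> projects G p (PIn s (Ls l))) ->
    is_oplus (lab L) Ls Lp ->
    projects (GComm q r L) p (PIn s Lp).

Definition projection (G : gtype) (p : participant) (P : proc) : Prop :=
  is_process P /\ projects G p P.

(* finite or infinite sequences of communications *)
CoInductive path : Type :=
| path_nil : path
| path_cons : comm -> path -> path.

(* paths of G from the root, not necessarily maximal *)
CoInductive gtype_path : gtype -> path -> Prop :=
| gtype_path_nil G : gtype_path G path_nil
| gtype_path_cons p q L l G w :
    L l = Some G -> gtype_path G w ->
    gtype_path (GComm p q L) (path_cons (p, l, q) w).

(* [depth w p n]: d(w, p) = n; it is infinite when there is no such n *)
Inductive depth : path -> participant -> nat -> Prop :=
| depth_nil p : depth path_nil p 0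
| depth_here p c w : involved p c -> depth (path_cons c w) p 0
| depth_next p c w n :
    ~ involved p c -> depth w p n -> depth (path_cons c w) p (S n).

Definition depth_bound (G : gtype) (p : participant) (k : nat) : Prop :=
  forall w, gtype_path G w -> exists n, depth w p n /\ n <= k.

(* [weight G p k]: the weight of p in G is the natural number k; it is
   infinite when there is no such k *)
Definition weight (G : gtype) (p : participant) (k : nat) : Prop :=
  (gtype_pt p G /\ depth_bound G p k /\
     (forall k', depth_bound G p k' -> k <= k')) \/
  (~ gtype_pt p G /\ k = 0).

Definition well_formed (G : gtype) : Prop :=
  forall p, gtype_pt p G ->
    (exists k, weight G p k) /\ (exists P, projection G p P).

(** * Typing *)

CoInductive structural_le : proc -> proc -> Prop :=
| structural_le_end : structural_le PEnd PEnd
| structural_le_in p L L' :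
    (forall l, lab L' l -> lab L l) ->
    (forall l P P', L l = Some P -> L' l = Some P' -> structural_le P P') ->
    structural_le (PIn p L) (PIn p L')
| structural_le_out p L L' :
    (forall l, lab L l <-> lab L' l) ->
    (forall l P P', L l = Some P -> L' l = Some P' -> structural_le P P') ->
    structural_le (POut p L) (POut p L').

Definition typed (M : session) (G : gtype) : Prop :=
  (forall p P, In (p, P) M ->
     exists Q, projection G p Q /\ structural_le P Q) /\
  (forall p, gtype_pt p G -> In p (participants M)).

(* Main.v *)
(** The residual of a global type after a communication that is not at its root
    need not be projectable: the merge of equal or label-disjoint projections is
    not stable under removing branches.  What is stable is the weaker relation
    "[P] plays the role of [p] in [G]", in which a process that is not involved
    in the first communication must play its role in every branch.  It follows
    from [P] being below the projection of [G], it is preserved when a process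
    of the session sends to another one ([G] being replaced by its residual),
    and it lets the session perform any communication at the root of [G].
    Lock-freedom follows by walking along a path of [G] to the participant. *)
Require Import Defs.
From Stdlib Require Import Arith List Permutation Relations Bool.
Import ListNotations.

Set Implicit Arguments.

(** * Playing a role in a global type *)

(** The structural preorder is built in: a receiver may offer more labels than the type, while a
    sender has exactly those of the type. As in [projects], the premise [gtype_pt] of
    [realizes_other] keeps an infinite type that never mentions [p] from accepting every process. *)
CoInductive realizes : gtype -> participant -> proc -> Prop :=
| realizes_notin G p : ~ gtype_pt p G -> realizes G p PEnd
| realizes_sender p q L Lp :
    (forall l, lab L l <-> lab Lp l) ->
    (forall l G P, L l = Some G -> Lp l = Some P -> realizes G p P) ->
    realizes (GComm p q L) p (POut q Lp)
| realizes_receiver p q L Lp :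
    q <> p ->
    (forall l, lab L l -> lab Lp l) ->
    (forall l G P, L l = Some G -> Lp l = Some P -> realizes G p P) ->
    realizes (GComm q p L) p (PIn q Lp)
| realizes_other p q r L P :
    p <> q -> p <> r -> gtype_pt p (GComm q r L) ->
    (forall l G, L l = Some G -> realizes G p P) ->
    realizes (GComm q r L) p P.

Lemma lab_some T (L : branches T) l t : L l = Some t -> lab L l.
Proof. unfold lab; congruence. Qed.

Lemma some_lab T (L : branches T) l : lab L l -> exists t, L l = Some t.
Proof. unfold lab; destruct (L l); [eauto | congruence]. Qed.

(** The only delicate clause is the disjoint merge: each [Ls l] is part of [Lp], and inputs may be
    wider than those above them, so a process below [PIn s Lp] is also below every [PIn s (Ls l)].
    The same [P] therefore serves all branches. *)
Lemma projects_le_realizes :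
  forall G p Q P, projects G p Q -> structural_le P Q -> realizes G p P.
Proof.
  cofix CH; intros G p Q P HQ HP.
  destruct HQ as [G p Hn | p q L Lp Hl Hs | p q L Lp Hne Hl Hs
                 | p q r L Q H1 H2 Hpt Hs | p q r s L Ls Lp H1 H2 Hpt Hs Ho].
  - inversion HP; subst; now apply realizes_notin.
  - inversion HP as [| |? L1 ? Hl1 Hs1]; subst; apply realizes_sender.
    + intro l; rewrite Hl, Hl1; reflexivity.
    + intros l G P HG HPl.
      destruct (some_lab (proj1 (Hl l) (lab_some _ _ HG))) as [Q HQ].
      apply CH with Q; eauto.
  - inversion HP as [|? L1 ? Hl1 Hs1|]; subst; apply realizes_receiver; auto.
    + intros l Hll; apply Hl1, Hl, Hll.
    + intros l G P HG HPl.
      destruct (some_lab (proj1 (Hl l) (lab_some _ _ HG))) as [Q HQ].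
      apply CH with Q; eauto.
  - apply realizes_other; auto.
    intros l G HG; apply CH with Q; eauto.
  - apply realizes_other; auto.
    intros l G HG; apply CH with (PIn s (Ls l)); [eauto|].
    assert (Hsub : forall m t, Ls l m = Some t -> Lp m = Some t).
    { intros m t Hm; apply Ho; exists l; split; [|exact Hm].
      eapply lab_some; eauto. }
    inversion HP as [|? L1 ? Hl1 Hs1|]; subst; apply structural_le_in.
    + intros m Hm; destruct (some_lab Hm) as [t Ht].
      eapply Hl1, lab_some; eauto.
    + eauto.
Qed.

Lemma realizes_le :
  forall G p Q P, realizes G p Q -> structural_le P Q -> realizes G p P.
Proof.
  cofix CH; intros G p Q P HQ HP.
  destruct HQ as [G p Hn | p q L Lp Hl Hs | p q L Lp Hne Hl Hs
                 | p q r L Q H1 H2 Hpt Hs].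
  - inversion HP; subst; now apply realizes_notin.
  - inversion HP as [| |? L1 ? Hl1 Hs1]; subst; apply realizes_sender.
    + intro l; rewrite Hl, Hl1; reflexivity.
    + intros l G P HG HPl.
      destruct (some_lab (proj1 (Hl l) (lab_some _ _ HG))) as [Q HQ].
      apply CH with Q; eauto.
  - inversion HP as [|? L1 ? Hl1 Hs1|]; subst; apply realizes_receiver; auto.
    intros l G P HG HPl.
    destruct (some_lab (Hl l (lab_some _ _ HG))) as [Q HQ].
    apply CH with Q; eauto.
  - apply realizes_other; auto.
    intros l G HG; apply CH with Q; eauto.
Qed.

(** * Equality of processes as trees *)

Lemma proc_eq_refl : forall P, proc_eq P P.
Proof.
  cofix CH; intros [|p L|p L]; constructor; try reflexivity;
    intros l P P' H H'; rewrite H in H'; injection H' as <-; apply CH.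
Qed.

Lemma proc_eq_sym : forall P Q, proc_eq P Q -> proc_eq Q P.
Proof.
  cofix CH; intros P Q [|p L L' Hl Hs|p L L' Hl Hs]; constructor;
    solve [intro l; symmetry; apply Hl | intros; apply CH; eapply Hs; eassumption].
Qed.

Lemma proc_eq_le : forall P Q, proc_eq P Q -> structural_le P Q.
Proof.
  cofix CH; intros P Q [|p L L' Hl Hs|p L L' Hl Hs]; constructor;
    solve [intro l; apply Hl | intros; apply CH; eauto].
Qed.

Lemma structural_le_pt p P Q : structural_le P Q -> proc_pt p Q -> proc_pt p P.
Proof.
  intros HP HQ; revert P HP.
  induction HQ as [L|L|q L l Q HL HQ IH|q L l Q HL HQ IH]; intros P HP;
    inversion HP as [|? L1 ? Hl1 Hs1|? L1 ? Hl1 Hs1]; subst.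
  - apply proc_pt_in.
  - apply proc_pt_out.
  - destruct (some_lab (Hl1 l (lab_some _ _ HL))) as [P' HP'].
    eapply proc_pt_in_next; eauto.
  - destruct (some_lab (proj2 (Hl1 l) (lab_some _ _ HL))) as [P' HP'].
    eapply proc_pt_out_next; eauto.
Qed.

(** Following the finite path to a communication of [p], the same process is carried down by
    [realizes_other]; where [p] takes part, only an input or an output fits. *)
Lemma realizes_pt_neq p G P : gtype_pt p G -> realizes G p P -> P <> PEnd.
Proof.
  intros Hpt HP ->; induction Hpt as [q L|q L|q r L l G HG Hpt IH];
    inversion HP as [? ? Hn| | |? ? ? ? ? H1 H2 Hpt' Hs]; subst;
    try congruence.
  - apply Hn; constructor.
  - apply Hn; constructor.
  - apply Hn; eapply gtype_pt_next; eauto.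
  - eauto.
Qed.

Lemma realizes_neq_pt p G P : realizes G p P -> P <> PEnd -> gtype_pt p G.
Proof. intros [] HP; solve [congruence | constructor | assumption]. Qed.

(** * Residuals *)

(** On each path the first communication from [p] to [q] is replaced by its branch [l]. The default
    [GEnd] for a missing [l] is never reached when the type is [enabled]. *)
CoFixpoint residual (p : participant) (l : message) (q : participant)
    (G : gtype) : gtype :=
  match G with
  | GEnd => GEnd
  | GComm r s L =>
      if Nat.eqb r p && Nat.eqb s q
      then match L l with Some H => H | None => GEnd end
      else GComm r s (fun m => match L m with
                               | Some H => Some (residual p l q H)
                               | None => None
                               end)
  end.

Definition residual_branches p l q (L : branches gtype) : branches gtype :=
  fun m => match L m with Some H => Some (residual p l q H) | None => None end.

Definition gtype_unfold (G : gtype) : gtype :=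
  match G with GEnd => GEnd | GComm p q L => GComm p q L end.

Lemma gtype_unfoldE G : G = gtype_unfold G.
Proof. now destruct G. Qed.

Lemma residual_end p l q : residual p l q GEnd = GEnd.
Proof. now rewrite (gtype_unfoldE (residual _ _ _ _)). Qed.

Lemma residual_here p l q L H :
  L l = Some H -> residual p l q (GComm p q L) = H.
Proof.
  intro HL; rewrite (gtype_unfoldE (residual _ _ _ _)); simpl.
  rewrite !Nat.eqb_refl; simpl; rewrite HL; symmetry; apply gtype_unfoldE.
Qed.

Lemma residual_there p l q r s L :
  ~ (r = p /\ s = q) ->
  residual p l q (GComm r s L) = GComm r s (residual_branches p l q L).
Proof.
  intro Hne; rewrite (gtype_unfoldE (residual _ _ _ _)); simpl.
  destruct (Nat.eqb_spec r p), (Nat.eqb_spec s q); simpl; tauto.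
Qed.

Lemma residual_branches_lab p l q L m :
  lab (residual_branches p l q L) m <-> lab L m.
Proof.
  unfold lab, residual_branches; destruct (L m); split; congruence.
Qed.

Lemma residual_branches_some p l q L m K :
  residual_branches p l q L m = Some K ->
  exists H, L m = Some H /\ K = residual p l q H.
Proof.
  unfold residual_branches; destruct (L m); [|congruence].
  injection 1 as <-; eauto.
Qed.

(** * Residuals of types that enable a given communication *)

Section Enabled.

Variables (p q : participant) (l : message) (P Q : proc).

(** The continuations [P] and [Q] are fixed for the whole type: until [p] and [q] communicate,
    neither moves, so every branch sees the same two processes. *)
Definition enabled (G : gtype) : Prop :=
  (exists Lp, Lp l = Some P /\ realizes G p (POut q Lp)) /\
  (exists Lq, Lq l = Some Q /\ realizes G q (PIn p Lq)).

(* On every path of an enabled type the first communication that involves [p]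
   or [q] is the one from [p] to [q]. *)
Lemma enabled_comm r s L :
  enabled (GComm r s L) ->
  (r = p /\ s = q /\
     exists H, L l = Some H /\ realizes H p P /\ realizes H q Q) \/
  (p <> r /\ p <> s /\ q <> r /\ q <> s /\
     forall m H, L m = Some H -> enabled H).
Proof.
  intros [[Lp [HLp Hp]] [Lq [HLq Hq]]].
  inversion Hp as [|? ? ? ? Hl Hs| |? ? ? ? ? H1 H2 Hpt Hs]; subst.
  - left; do 2 (split; [reflexivity|]).
    destruct (some_lab (proj2 (Hl l) (lab_some _ _ HLp))) as [H HH].
    exists H; repeat split; eauto.
    inversion Hq as [| |? ? ? ? Hne Hl' Hs'|]; subst; [eauto|congruence].
  - right.
    inversion Hq as [| |? ? ? ? Hne Hl' Hs'|? ? ? ? ? H1' H2' Hpt' Hs'];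
      subst; [congruence|].
    repeat split; auto; [exists Lp | exists Lq]; eauto.
Qed.

(* [after t T G]: [T] is what the process of [t] becomes when [p] sends [l]
   to [q]. *)
Inductive after (t : participant) (T : proc) (G : gtype) : Prop :=
| after_sender : t = p -> T = P -> after t T G
| after_receiver : t = q -> T = Q -> after t T G
| after_other : t <> p -> t <> q -> realizes G t T -> after t T G.

Lemma after_here t T L H :
  enabled (GComm p q L) -> after t T (GComm p q L) -> L l = Some H ->
  realizes H t T.
Proof.
  intros HE HA HL.
  destruct (enabled_comm HE) as [[_ [_ [H' [HL' [HP HQ]]]]]|]; [|tauto].
  rewrite HL in HL'; injection HL' as <-.
  destruct HA as [-> ->| -> ->|H1 H2 HT]; auto.
  inversion HT as [? ? Hn| | |? ? ? ? ? ? ? Hpt Hs]; subst; try congruence.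
  - apply realizes_notin; intro Hpt; apply Hn; eapply gtype_pt_next; eauto.
  - eauto.
Qed.

Lemma after_there t T r s L m H :
  p <> r -> p <> s -> q <> r -> q <> s -> t <> r -> t <> s ->
  after t T (GComm r s L) -> L m = Some H -> after t T H.
Proof.
  intros ? ? ? ? ? ? [-> ->| -> ->|H1 H2 HT] HL.
  - now apply after_sender.
  - now apply after_receiver.
  - apply after_other; auto.
    inversion HT as [? ? Hn| | |? ? ? ? ? ? ? Hpt Hs]; subst; try congruence.
    + apply realizes_notin; intro Hpt; apply Hn; eapply gtype_pt_next; eauto.
    + eauto.
Qed.

Lemma after_pt t T G : enabled G -> after t T G -> T <> PEnd -> gtype_pt t G.
Proof.
  intros [[Lp [_ Hp]] [Lq [_ Hq]]] [-> _| -> _|_ _ HT] HTne.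
  - eapply realizes_neq_pt; [exact Hp|congruence].
  - eapply realizes_neq_pt; [exact Hq|congruence].
  - eapply realizes_neq_pt; eauto.
Qed.

(** The occurrence of [t] in [G] may be the very communication that is deleted. In that case [T]
    plays [t] in the chosen branch, and being nonzero it forces [t] to occur there. *)
Lemma residual_neq_pt t T G :
  enabled G -> after t T G -> T <> PEnd -> gtype_pt t (residual p l q G).
Proof.
  intros HE HA HT; pose proof (after_pt HE HA HT) as Hpt.
  induction Hpt as [s L|r L|r s L m G HG Hpt IH];
    destruct (enabled_comm HE)
      as [[-> [-> [H [HL _]]]]|[H1 [H2 [H3 [H4 HE']]]]];
    try (rewrite (residual_here _ _ _ _ HL); eapply realizes_neq_pt;
         [eapply after_here; eauto|assumption]);
    rewrite residual_there by intuition congruence.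
  - constructor.
  - constructor.
  - destruct (Nat.eq_dec t r) as [->|Hr]; [constructor|].
    destruct (Nat.eq_dec t s) as [->|Hs]; [constructor|].
    apply gtype_pt_next with m (residual p l q G).
    + unfold residual_branches; now rewrite HG.
    + apply IH; [eauto|]. eapply after_there; [..|exact HA|exact HG]; auto.
Qed.

Lemma residual_pt_neq t T G :
  enabled G -> after t T G -> gtype_pt t (residual p l q G) -> T <> PEnd.
Proof.
  intros HE HA Hpt; remember (residual p l q G) as K eqn:HK.
  revert G HE HA HK.
  induction Hpt as [s L|r L|r s L m K HmK Hpt IH]; intros [|r' s' L'] HE HA HK;
    try (rewrite residual_end in HK; discriminate);
    (destruct (enabled_comm HE)
      as [[-> [-> [H [HL _]]]]|[H1 [H2 [H3 [H4 HE']]]]];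
     [rewrite (residual_here _ _ _ _ HL) in HK; subst H;
      eapply realizes_pt_neq; [|eapply after_here; eauto];
      first [apply gtype_pt_sender | apply gtype_pt_receiver
             | eapply gtype_pt_next; eauto]
     |rewrite residual_there in HK by (intuition congruence);
      injection HK as -> -> ->]).
  - destruct HA as [-> _| -> _|_ _ HT]; try congruence.
    eapply realizes_pt_neq; [|exact HT]; constructor.
  - destruct HA as [-> _| -> _|_ _ HT]; try congruence.
    eapply realizes_pt_neq; [|exact HT]; constructor.
  - destruct (residual_branches_some _ _ _ _ _ HmK) as [H [HH ->]].
    destruct (Nat.eq_dec t r') as [->|Hr];
      [|destruct (Nat.eq_dec t s') as [->|Hs]].
    1, 2: destruct HA as [-> _| -> _|_ _ HT]; try congruence;
      eapply realizes_pt_neq; [|exact HT]; constructor.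
    apply (IH H); [eauto| |reflexivity].
    eapply after_there; [..|exact HA|exact HH]; auto.
Qed.

(** Above the deleted communication the root is unchanged and its two participants differ from [p]
    and [q]; everyone else passes to all branches. At the deleted communication [after_here]
    concludes. *)
Lemma residual_realizes :
  forall t T G, enabled G -> after t T G -> realizes (residual p l q G) t T.
Proof.
  cofix CH; intros t T G HE HA.
  (* Whether [t] occurs in the residual is decided by inspecting [T], which avoids a classical case
     distinction on [gtype_pt]. *)
  assert (HT : T = PEnd \/ T <> PEnd) by (destruct T; [left|right|right]; congruence).
  destruct HT as [->|HT].
  { apply realizes_notin; intro Hpt; exact (residual_pt_neq HE HA Hpt eq_refl). }
  pose proof (residual_neq_pt HE HA HT) as Hpt.
  destruct G as [|r s L].
  { rewrite residual_end in Hpt; inversion Hpt. }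
  destruct (enabled_comm HE)
      as [[-> [-> [H [HL _]]]]|[H1 [H2 [H3 [H4 HE']]]]].
  { rewrite (residual_here _ _ _ _ HL); eapply after_here; eauto. }
  rewrite residual_there in * by intuition congruence.
  (* A participant of the surviving root is neither [p] nor [q], so its process has not changed. *)
  assert (Hin : t = r \/ t = s -> t <> p /\ t <> q /\ realizes (GComm r s L) t T).
  { intro Ht; destruct HA as [-> _| -> _|]; [exfalso|exfalso|tauto];
      destruct Ht; congruence. }
  assert (Ht : (t <> r /\ t <> s) \/ (t = r \/ t = s))
    by (destruct (Nat.eq_dec t r), (Nat.eq_dec t s); tauto).
  destruct Ht as [[Hr Hs]|Ht].
  { apply realizes_other; auto.
    intros m K HK.
    destruct (residual_branches_some _ _ _ _ _ HK) as [H [HH ->]].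
    apply CH; [eauto|]. eapply after_there; [..|exact HA|exact HH]; auto. }
  destruct (Hin Ht) as [Hp [Hq HR]]; clear Hin.
  inversion HR as [|? ? ? Lt Hl Hs|? ? ? Lt Hne Hl Hs|? ? ? ? ? Hr Hs]; subst.
  - congruence.
  - apply realizes_sender.
    + intro m; rewrite residual_branches_lab; apply Hl.
    + intros m K T HK HTm.
      destruct (residual_branches_some _ _ _ _ _ HK) as [H [HH ->]].
      apply CH; [eauto|]. apply after_other; eauto.
  - apply realizes_receiver; auto.
    + intro m; rewrite residual_branches_lab; apply Hl.
    + intros m K T HK HTm.
      destruct (residual_branches_some _ _ _ _ _ HK) as [H [HH ->]].
      apply CH; [eauto|]. apply after_other; eauto.
  - destruct Ht; congruence.
Qed.

End Enabled.

Lemma residual_pt p l q t G : gtype_pt t (residual p l q G) -> gtype_pt t G.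
Proof.
  assert (Hin : forall r s L K, gtype_pt t K ->
    K = match L l with Some H => H | None => GEnd end ->
    gtype_pt t (GComm r s L)).
  { intros r s L K HK ->; destruct (L l) eqn:HL; [|inversion HK].
    eapply gtype_pt_next; eauto. }
  intro Hpt; remember (residual p l q G) as K eqn:HK; revert G HK.
  induction Hpt as [s L|r L|r s L m K' HmK Hpt IH]; intros [|r' s' L'] HK;
    try (rewrite residual_end in HK; discriminate);
    rewrite (gtype_unfoldE (residual _ _ _ _)) in HK; simpl in HK;
    destruct (Nat.eqb r' p && Nat.eqb s' q);
    try (eapply Hin; [|etransitivity; [exact HK|symmetry; apply gtype_unfoldE]];
         solve [apply gtype_pt_sender | apply gtype_pt_receiver
               | eapply gtype_pt_next; eauto]);
    injection HK as -> -> HK.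
  - constructor.
  - constructor.
  - subst L. destruct (L' m) as [H|] eqn:HH; [|discriminate].
    injection HmK as <-; eapply gtype_pt_next; eauto.
Qed.

(** * Nonempty choices *)

(** This provides a label to perform at every root, and it passes to residuals. *)
CoInductive branching : gtype -> Prop :=
| branching_end : branching GEnd
| branching_comm p q L :
    (exists l, lab L l) -> (forall l G, L l = Some G -> branching G) ->
    branching (GComm p q L).

Lemma is_gtype_branching G : is_gtype G -> branching G.
Proof.
  intros [Hprop _].
  assert (HG : forall p q L, gtype_sub G (GComm p q L) -> exists l, lab L l)
    by (intros; eapply Hprop; eauto).
  clear Hprop; revert G HG; cofix CH; intros [|p q L] HG; constructor.
  - eapply HG, gtype_sub_refl.
  - intros l G HL; apply CH; intros; eapply HG, gtype_sub_comm; eauto.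
Qed.

Lemma branching_residual : forall p l q G,
  branching G -> branching (residual p l q G).
Proof.
  cofix CH; intros p l q G HG.
  rewrite (gtype_unfoldE (residual _ _ _ _)).
  destruct HG as [|r s L Hl Hs]; simpl; [constructor|].
  destruct (Nat.eqb r p && Nat.eqb s q).
  - destruct (L l) as [[|]|] eqn:HL; solve [constructor | exact (Hs _ _ HL)].
  - constructor.
    + destruct Hl as [m Hm]; exists m; now apply residual_branches_lab.
    + intros m K HK; destruct (residual_branches_some _ _ _ _ _ HK) as [H [HH ->]].
      apply CH; eauto.
Qed.

(** * Sessions *)

(** The invariant of reduction. The condition [~ proc_pt p P] rules out communications of a
    participant with itself, which [realizes] alone would allow. *)
Record implements (M : session) (G : gtype) : Prop := {
  impl_nodup : NoDup (participants M);
  impl_proc : forall p P, In (p, P) M -> realizes G p P /\ ~ proc_pt p P;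
  impl_pt : forall p, gtype_pt p G -> In p (participants M);
  impl_branching : branching G }.

Lemma typed_implements M G :
  is_session M -> is_gtype G -> typed M G -> implements M G.
Proof.
  intros [Hnd HM] HG [Hproc Hpt]; constructor; auto using is_gtype_branching.
  intros p P HP; split; [|apply HM; auto].
  destruct (Hproc p P HP) as [Q [[_ HQ] Hle]].
  eapply projects_le_realizes; eauto.
Qed.

Lemma implements_perm M M' G :
  Permutation M M' -> implements M G -> implements M' G.
Proof.
  intros HM [Hnd Hproc Hpt HG].
  assert (Hp : Permutation (participants M) (participants M'))
    by now apply Permutation_map.
  constructor; auto.
  - eapply Permutation_NoDup; eauto.
  - intros p P HP; apply Hproc; eapply Permutation_in;
      [apply Permutation_sym|]; eauto.
  - intros p HpG; eapply Permutation_in; eauto.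
Qed.

(** Dropping [p] is safe because a participant of [G] cannot be played by [PEnd]; adding it is safe
    because the participants of [G] are already in [M]. *)
Lemma implements_neutral p M G :
  ~ In p (participants M) -> implements ((p, PEnd) :: M) G <-> implements M G.
Proof.
  intro Hp; split; intros [Hnd Hproc Hpt HG]; constructor; auto.
  - now inversion Hnd.
  - intros; apply Hproc; now right.
  - intros r Hr; destruct (Hpt r Hr) as [<-|Hin]; auto.
    destruct (Hproc p PEnd (or_introl eq_refl)) as [HE _].
    now destruct (realizes_pt_neq Hr HE).
  - now constructor.
  - intros r P [E|HP]; auto; injection E as <- <-; split.
    + apply realizes_notin; auto.
    + intro H; inversion H.
  - intros r Hr; right; auto.
Qed.

Lemma implements_proc p P P' M G :
  proc_eq P P' -> implements ((p, P) :: M) G -> implements ((p, P') :: M) G.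
Proof.
  intros HP [Hnd Hproc Hpt HG]; constructor; auto.
  intros r R [E|HR]; [injection E as <- <-|apply Hproc; now right].
  destruct (Hproc p P (or_introl eq_refl)) as [HR Hn]; split.
  - eapply realizes_le; [exact HR|]; now apply proc_eq_le, proc_eq_sym.
  - intro Hn'; apply Hn; eapply structural_le_pt; [|exact Hn'].
    now apply proc_eq_le.
Qed.

Lemma implements_scong M M' G :
  scong M M' -> implements M G <-> implements M' G.
Proof.
  induction 1 as [M M' HM|p M Hp|p P P' M HP|M M' _ IH|M M' M'' _ IH1 _ IH2].
  - split; apply implements_perm; auto using Permutation_sym.
  - now apply implements_neutral.
  - split; apply implements_proc; auto using proc_eq_sym.
  - now symmetry.
  - now rewrite IH1.
Qed.

Lemma badd_here T l (t : T) L : badd l t L l = Some t.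
Proof. unfold badd; now rewrite Nat.eqb_refl. Qed.

(** Subject reduction: the two leading processes make [G] enabled, and every process of the reduct
    is then in the relation [after]. *)
Lemma implements_residual p q l P Q L L' M G :
  implements ((p, POut q (badd l P L)) :: (q, PIn p (badd l Q L')) :: M) G ->
  implements ((p, P) :: (q, Q) :: M) (residual p l q G).
Proof.
  intros [Hnd Hproc Hpt HG].
  destruct (Hproc _ _ (or_introl eq_refl)) as [Hp Hnp].
  destruct (Hproc _ _ (or_intror (or_introl eq_refl))) as [Hq Hnq].
  assert (HE : enabled p q l P Q G).
  { split; [exists (badd l P L) | exists (badd l Q L')];
      split; auto using badd_here. }
  constructor; auto.
  - intros r R HR; split.
    + apply (residual_realizes HE).
      destruct HR as [E|[E|HR]].
      * injection E as <- <-; now apply after_sender.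
      * injection E as <- <-; now apply after_receiver.
      * simpl in Hnd; apply NoDup_cons_iff in Hnd as [Hn1 Hnd].
        apply NoDup_cons_iff in Hnd as [Hn2 _].
        assert (Hr : In r (participants M)) by exact (in_map fst _ _ HR).
        apply after_other.
        -- intros ->; apply Hn1; now right.
        -- intros ->; auto.
        -- apply Hproc; now do 2 right.
    + destruct HR as [E|[E|HR]].
      * injection E as <- <-; intro; apply Hnp.
        eapply proc_pt_out_next; eauto using badd_here.
      * injection E as <- <-; intro; apply Hnq.
        eapply proc_pt_in_next; eauto using badd_here.
      * apply Hproc; now do 2 right.
  - intros r Hr; apply Hpt; eapply residual_pt; eauto.
  - now apply branching_residual.
Qed.

Lemma implements_red M c M' G :
  red M c M' -> implements M G -> exists G', implements M' G'.
Proof.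
  intro HR; revert G;
    induction HR as [p q l P Q L L' M|M1 M1' c M2 M2' H1 _ IH H2]; intros G HM.
  - eauto using implements_residual.
  - apply (implements_scong G H1) in HM.
    destruct (IH G HM) as [G' HG']; exists G'.
    now apply (implements_scong G' H2).
Qed.

Lemma implements_reds M M' G :
  reds M M' -> implements M G -> exists G', implements M' G'.
Proof.
  intro HR; revert G; induction HR as [M M' [HM|[c HM]]|M|M M1 M2 _ IH1 _ IH2];
    intros G HG.
  - exists G; now apply (implements_scong G HM).
  - eapply implements_red; eauto.
  - eauto.
  - destruct (IH1 G HG); eauto.
Qed.

(** * Performing the communication at the root *)

(** Brings arbitrary branches into the form [badd l P L] with [l] fresh that [red_comm] requires.
    The result agrees with the original only pointwise, hence the passage through [proc_eq] and
    [scong_proc]. *)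
Definition remove_label T (l : message) (L : branches T) : branches T :=
  fun m => if Nat.eqb m l then None else L m.

Lemma remove_label_notin T l (L : branches T) : ~ lab (remove_label l L) l.
Proof. unfold lab, remove_label; rewrite Nat.eqb_refl; congruence. Qed.

Lemma remove_label_incl T U l (L : branches T) (L' : branches U) :
  (forall m, lab L m -> lab L' m) ->
  forall m, lab (remove_label l L) m -> lab (remove_label l L') m.
Proof.
  intros H m; specialize (H m); unfold lab, remove_label in *.
  destruct (Nat.eqb m l); auto.
Qed.

Lemma badd_remove_label T l (t : T) L m :
  L l = Some t -> badd l t (remove_label l L) m = L m.
Proof.
  unfold badd, remove_label; intro HL.
  destruct (Nat.eqb_spec m l); congruence.
Qed.

Lemma proc_eq_badd_out p l P L :
  L l = Some P -> proc_eq (POut p L) (POut p (badd l P (remove_label l L))).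
Proof.
  intro HL; constructor; intros m.
  - unfold lab; now rewrite badd_remove_label.
  - intros R R'; rewrite badd_remove_label by assumption.
    intros -> E; injection E as <-; apply proc_eq_refl.
Qed.

Lemma proc_eq_badd_in p l P L :
  L l = Some P -> proc_eq (PIn p L) (PIn p (badd l P (remove_label l L))).
Proof.
  intro HL; constructor; intros m.
  - unfold lab; now rewrite badd_remove_label.
  - intros R R'; rewrite badd_remove_label by assumption.
    intros -> E; injection E as <-; apply proc_eq_refl.
Qed.

Lemma participants_in M p :
  In p (participants M) -> exists P M', Permutation M ((p, P) :: M').
Proof.
  intro Hp; apply in_map_iff in Hp as [[p' P] [E HP]]; simpl in E; subst p'.
  apply in_split in HP as [M1 [M2 ->]]; exists P, (M1 ++ M2).
  symmetry; apply Permutation_middle.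
Qed.

Lemma implements_comm M p q L l G :
  implements M (GComm p q L) -> L l = Some G ->
  exists M', red M (p, l, q) M' /\ implements M' G.
Proof.
  intros HM HG.
  destruct (participants_in M p (impl_pt HM (gtype_pt_sender _ _ _)))
    as [P0 [M1 HM1]].
  apply (implements_perm HM1) in HM as HM'.
  destruct (impl_proc HM' _ _ (or_introl eq_refl)) as [HP HPn].
  inversion HP as [? ? Hn|? ? ? Lp Hlp Hsp| |]; subst;
    [destruct Hn; constructor| |congruence|congruence].
  (* A process of [p] that outputs to [p] would mention its own participant. *)
  assert (Hpq : q <> p) by (intros ->; apply HPn; constructor).
  assert (Hq : In q (participants M1)).
  { destruct (impl_pt HM' (gtype_pt_receiver _ _ _)) as [E|Hq]; [|exact Hq].
    now destruct Hpq. }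
  destruct (participants_in M1 q Hq) as [Q0 [M2 HM2]].
  assert (HMp : Permutation M ((q, Q0) :: (p, POut q Lp) :: M2)).
  { rewrite HM1, HM2; apply perm_swap. }
  apply (implements_perm HMp) in HM as HM''.
  destruct (impl_proc HM'' _ _ (or_introl eq_refl)) as [HQ HQn].
  inversion HQ as [? ? Hn| |? ? ? Lq Hne Hlq Hsq|]; subst;
    [destruct Hn; constructor|congruence| |congruence].
  destruct (some_lab (proj1 (Hlp l) (lab_some _ _ HG))) as [P HPl].
  destruct (some_lab (Hlq l (lab_some _ _ HG))) as [Q HQl].
  set (N := (p, POut q (badd l P (remove_label l Lp))) ::
            (q, PIn p (badd l Q (remove_label l Lq))) :: M2).
  assert (HN : scong M N).
  { eapply scong_trans; [apply scong_perm, HMp|].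
    eapply scong_trans; [apply scong_proc, proc_eq_badd_in, HQl|].
    eapply scong_trans; [apply scong_perm, perm_swap|].
    apply scong_proc, proc_eq_badd_out, HPl. }
  exists ((p, P) :: (q, Q) :: M2); split.
  - eapply red_scong; [exact HN| |apply scong_perm, Permutation_refl].
    apply red_comm; auto using remove_label_notin.
    (* The sender has exactly the labels of the type, and the receiver accepts all of them. *)
    apply remove_label_incl; intros m Hm; apply Hlq, Hlp, Hm.
  - apply (implements_scong _ HN), implements_residual in HM.
    now rewrite (residual_here _ _ _ _ HG) in HM.
Qed.

(** * Lock-freedom *)

(** Induction on the finite path to [p] witnessed by [gtype_pt]: any branch at the root can be
    performed, in particular the one that leads to [p]. *)
Lemma implements_eventually p M G :
  implements M G -> gtype_pt p G ->
  exists M' c M'', reds M M' /\ red M' c M'' /\ involved p c.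
Proof.
  intros HM Hpt; revert M HM.
  induction Hpt as [q L|q L|q r L l G HG Hpt IH]; intros M HM.
  1, 2: pose proof (impl_branching HM) as HB; inversion HB as [|? ? ? Hl _]; subst;
    destruct Hl as [l Hl]; destruct (some_lab Hl) as [G HG];
    destruct (implements_comm _ HM HG) as [M' [HR _]];
    exists M; eexists; exists M'; split; [apply rt_refl|split; [exact HR|simpl; auto]].
  destruct (implements_comm _ HM HG) as [M' [HR HM']].
  destruct (IH M' HM') as [M1 [c [M2 [H1 [H2 H3]]]]].
  exists M1, c, M2; repeat split; auto.
  eapply rt_trans; [apply rt_step; right; eauto|exact H1].
Qed.

Lemma scong_all_end M :
  NoDup (participants M) -> (forall r R, In (r, R) M -> R = PEnd) ->
  exists r, scong M [(r, PEnd)].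
Proof.
  induction M as [|[r R] M IH]; intros Hnd HM.
  (* The empty product is congruent to any single idle participant; [0] is an arbitrary choice. *)
  - exists 0; apply scong_sym, scong_neutral; simpl; auto.
  - rewrite (HM r R (or_introl eq_refl)).
    apply NoDup_cons_iff in Hnd as [Hn Hnd].
    destruct IH as [s Hs]; [auto|intros; eapply HM; right; eauto|].
    exists s; eapply scong_trans; [|exact Hs]; now apply scong_neutral.
Qed.

Theorem mainTheorem3 :
  forall M : session,
    is_session M ->
    (exists G : gtype, is_gtype G /\ well_formed G /\ typed M G) ->
    lock_free M.
Proof.
  intros M HM [G [HG [_ HT]]].
  pose proof (typed_implements HM HG HT) as HI.
  split.
  - intros M' HR; destruct (implements_reds HR HI) as [[|p q L] HI'].
    (* The type has become [GEnd], so only [PEnd] can play a role in it. *)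
    + left; apply scong_all_end; [apply HI'|].
      intros r R Hr; destruct (impl_proc HI' _ _ Hr) as [Hreal _].
      now inversion Hreal.
    + right; pose proof (impl_branching HI') as HB.
      inversion HB as [|? ? ? [l Hl] _]; subst.
      destruct (some_lab Hl) as [H HH].
      destruct (implements_comm _ HI' HH) as [M'' [HR' _]]; eauto.
  - intros p P M' HR HP; destruct (implements_reds HR HI) as [G' HI'].
    (* It remains to see that [p] occurs in [G'], which follows from [P] being nonzero. *)
    eapply implements_eventually; [exact HI'|].
    destruct (impl_proc HI' _ _ (or_introl eq_refl)).
    eapply realizes_neq_pt; eauto.
Qed.
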